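(* Let $d\in\mathbb{N}$ with $d\geq 2$. Then there is a monotone increasing function $\beta_{d}\colon [1,\infty)\to [1,\infty)$, with $2\lfloor t\rfloor-1\leq\beta_{d}(t)\leq 2^{8dt}$ for all $t\in [1,\infty)$, such that the following holds: For any $H\in\mathbb{N}$, $L\geq 1$ and any $L$-bilipschitz mapping \[f\colon \big(\mathbb{R}^{d-1}\times\{\tfrac{1}{2},H+\tfrac{1}{2}\}\big)\cup\big(\mathbb{Z}^{d-1}\times\{1,\ldots,H\}\big)\to\mathbb{R}^{d}\] satisfying $f(x)=x$ for all $x\in \mathbb{R}^{d-1}\times \{\frac{1}{2},H+\frac{1}{2}\}$ and $f(\mathbb{Z}^{d-1}\times\{1,\ldots,H\})\subseteq \mathbb{R}^{d-1}\times[\frac{1}{2},H+\frac{1}{2}]$, there is a bilipschitz extension $F\colon\mathbb{R}^{d}\to \mathbb{R}^{d}$ of $f$ with \[\operatorname{bilip}(F)\leq 2^{38}d^{9/2}L^{9}H^{2+\frac{3}{d-1}}\cdot \beta_{d}\big(2^{42}d^{9/2}L^{10}H^{3+\frac{3}{d-1}}\big)^{3^{d-1}}.\] Moreover, $\beta_d$ may be taken to be the function $\beta_d$ defined in the context below.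
   Context: For injective $f$, $\operatorname{bilip}(f)=\max\{\operatorname{Lip}(f),\operatorname{Lip}(f^{-1})\}$ with respect to the Euclidean norm; $L$-bilipschitz means $\operatorname{bilip}\le L$. Definition of $\beta_d$: let $\mathcal{F}_d$ be the collection of all monotone increasing functions $\psi\colon[1,\infty)\to[1,\infty)$ such that the following holds: for every $S\in\mathbb{N}$, with $Q:=(-\frac12,\dots,-\frac12)+[0,S]^{d-1}\subseteq\mathbb{R}^{d-1}$, and every permutation $\sigma\colon\mathbb{Z}^{d-1}\to\mathbb{Z}^{d-1}$ such that for each $z\in\mathbb{Z}^{d-1}$ the restriction of $\sigma$ to $\mathbb{Z}^{d-1}\cap(Q+Sz)$ is a permutation of $\mathbb{Z}^{d-1}\cap(Q+Sz)$, there is a $\psi(S)$-bilipschitz mapping $\Upsilon\colon\mathbb{R}^d\to\mathbb{R}^d$ with $\Upsilon(x)=x$ for all $x\in\mathbb{R}^{d-1}\times(\mathbb{R}\setminus(-\frac12,\frac12))$ and $\Upsilon(x,0)=(\sigma(x),0)$ for all $x\in\mathbb{Z}^{d-1}$. Then $\beta_d$ is the pointwise infimum of $\mathcal{F}_d$. *)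

(* Defs.v *)
From HB Require Import structures.
From mathcomp Require Import all_boot all_order all_algebra.
From mathcomp Require Import all_classical all_reals all_analysis.
Unset Printing Implicit Defensive.
Import Order.TTheory GRing.Theory Num.Theory.
Local Open Scope classical_set_scope.
Local Open Scope ring_scope.

Section Defs.
Variable R : realType.

Definition enorm {m : nat} (x : 'rV[R]_m) : R :=
  Num.sqrt (\sum_(i < m) x 0 i ^+ 2).

Definition bilip_on {m : nat} (L : R) (A : set 'rV[R]_m)
    (f : 'rV[R]_m -> 'rV[R]_m) : Prop :=
  forall x y, A x -> A y ->
    enorm (f x - f y) <= L * enorm (x - y) /\
    enorm (x - y) <= L * enorm (f x - f y).

Definition hpart {n : nat} (y : 'rV[R]_n.+1) : 'rV[R]_n :=
  \row_(j < n) y 0 (lift ord_max j).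
Definition vcoord {n : nat} (y : 'rV[R]_n.+1) : R := y 0 ord_max.
Definition pt {n : nat} (x : 'rV[R]_n) (t : R) : 'rV[R]_n.+1 :=
  \row_(i < n.+1) match unlift ord_max i with Some j => x 0 j | None => t end.

Definition zr {n : nat} (w : 'rV[int]_n) : 'rV[R]_n := \row_(j < n) (w 0 j)%:~R.

Definition is_int (x : R) : Prop := exists k : int, x = k%:~R.

Definition boundary_planes (n H : nat) : set 'rV[R]_n.+1 :=
  [set y | vcoord y = 2^-1 \/ vcoord y = H%:R + 2^-1].
Definition lattice_layers (n H : nat) : set 'rV[R]_n.+1 :=
  [set y | (forall j, is_int (hpart y 0 j)) /\
           exists k : nat, (1 <= k <= H)%N /\ vcoord y = k%:R].
Definition ext_domain (n H : nat) : set 'rV[R]_n.+1 :=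
  boundary_planes n H `|` lattice_layers n H.
Definition slab (n H : nat) : set 'rV[R]_n.+1 :=
  [set y | 2^-1 <= vcoord y <= H%:R + 2^-1].

Definition block (n S : nat) (z : 'rV[int]_n) : set 'rV[int]_n :=
  [set w | forall j, - 2^-1 + S%:R * (z 0 j)%:~R <= (w 0 j)%:~R :> R /\
                     (w 0 j)%:~R <= - 2^-1 + S%:R + S%:R * (z 0 j)%:~R :> R].

Definition block_perm (n S : nat) (sigma : 'rV[int]_n -> 'rV[int]_n) : Prop :=
  bijective sigma /\
  forall z, (forall w, block n S z w -> block n S z (sigma w)) /\
            (forall w', block n S z w' -> exists2 w, block n S z w & sigma w = w').

(* The class F_d (with d = n.+1): monotone psi : [1,oo) -> [1,oo)
   (represented as R -> R, only values on [1,oo) matter) with the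
   permutation-realization property. *)
Definition F_class (n : nat) : set (R -> R) :=
  [set psi |
    (forall t, 1 <= t -> 1 <= psi t) /\
    (forall s t, 1 <= s -> s <= t -> psi s <= psi t) /\
    forall (S : nat) (sigma : 'rV[int]_n -> 'rV[int]_n),
      (1 <= S)%N -> block_perm n S sigma ->
      exists Ups : 'rV[R]_n.+1 -> 'rV[R]_n.+1,
        bilip_on (psi S%:R) setT Ups /\
        (forall x, `|vcoord x| >= 2^-1 -> Ups x = x) /\
        (forall z, Ups (pt (zr z) 0) = pt (zr (sigma z)) 0)].

(* beta_d (d = n.+1) : pointwise infimum of F_d. *)
Definition beta (n : nat) (t : R) : R := inf [set psi t | psi in F_class n].

End Defs.

Arguments enorm {R m}.
Arguments bilip_on {R m}.
Arguments hpart {R n}.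
Arguments vcoord {R n}.
Arguments pt {R n}.
Arguments zr {R n}.

(* Main.v *)
Require Import Defs.
From HB Require Import structures.
From mathcomp Require Import all_boot all_order all_algebra.
From mathcomp Require Import all_classical all_reals all_analysis.
From mathcomp Require Import ring lra zify.
Import Order.TTheory GRing.Theory Num.Theory.
Local Open Scope classical_set_scope.
Local Open Scope ring_scope.

(* By the reflection permutation, beta(T) >= 2 floor(T) - 1 >= T for T >= 3, so
   an extension whose bilipschitz constant is polynomial in L and H suffices.
   Write q(z,k) = (x,y) for the prescribed image of the lattice point (z,k): the
   q's are separated, stay in the slab and satisfy |x - z| <= L H.  Colour (z,k)
   by k and the residues of z modulo N >> L H.  The extension is a composition
   of four moves, each equal to the identity off the slab:
     (z,k) -> (z,tau)    vertical; the height tau depends only on the colour and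
                         separates the colours;
     (z,tau) -> (x',tau) horizontal; points of one colour are far apart, so the
                         displacement is 1/2-Lipschitz at a fixed height.  Here
                         x' is x with one coordinate rounded to a fine grid coset
                         attached to the colour, which separates all the x';
     (x',tau) -> (x',y)  vertical; no two points share a vertical line;
     (x',y) -> (x,y)     horizontal, undoing the rounding.
   Every move comes from a McShane extension of its displacement.  The case H = 1
   also realizes every block permutation, whence beta(t) <= 2^(8dt). *)

(** * McShane extension for an asymmetric gauge *)

(* The gauge G need not be symmetric: an asymmetric one also yields lower bounds
   on the increments of phi, as needed for monotone extensions. *)
Lemma mcshane (R : realType) (V : zmodType) (G : V -> R) (I : Type)
    (D : set I) (a : I -> V) (w : I -> R) :
  G 0 = 0 -> (forall x y, G (x + y) <= G x + G y) ->
  D !=set0 ->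
  (forall i j, D i -> D j -> w i - w j <= G (a i - a j)) ->
  exists phi : V -> R, (forall i, D i -> phi (a i) = w i) /\
    forall x y, phi x - phi y <= G (x - y).
Proof.
move=> G0 GD [i0 Di0] wG.
(* The extension is the infimum of the translates [w i + G (x - a i)]. Compatibility of the data and
   subadditivity of [G] bound them below, sharply at the points [a i]. *)
pose A x := [set w i + G (x - a i) | i in D].
have lbA x j : D j -> lbound (A x) (w j - G (a j - x)).
  move=> Dj _ [i Di <-].
  have := wG j i Dj Di.
  have := GD (a j - x) (x - a i); rewrite addrA subrK; lra.
have A0 x : A x !=set0 by exists (w i0 + G (x - a i0)), i0.
have hA x : has_inf (A x) by split=> //; exists (w i0 - G (a i0 - x)); exact: lbA.
exists (fun x => inf (A x)); split=> [i Di|x y].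
  apply/eqP; rewrite eq_le; apply/andP; split.
    apply: ge_inf; first by case: (hA (a i)).
    by exists i => //; rewrite subrr G0 addr0.
  apply: lb_le_inf => //.
  by have := lbA (a i) i Di; rewrite subrr G0 subr0.
rewrite lerBlDr -lerBlDl; apply: lb_le_inf => // _ [i Di <-].
rewrite lerBlDl addrCA; apply: (@le_trans _ _ (w i + G (x - a i))).
  by apply: ge_inf; [case: (hA x)|exists i].
by rewrite lerD2l; have := GD (x - y) (y - a i); rewrite addrA subrK.
Qed.

(** * Maximum norm, and the splitting of a point into horizontal part and height *)

Lemma mxnorm_ge (R : realType) (n : nat) (x : 'rV[R]_n) j : `|x 0 j| <= `|x|.
Proof.
rewrite [leRHS]/Num.Def.normr/= mx_normrE.
by apply/bigmax_geP; right; exists (0, j).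
Qed.

Lemma mxnorm_le (R : realType) (n : nat) (x : 'rV[R]_n) c :
  0 <= c -> (forall j, `|x 0 j| <= c) -> `|x| <= c.
Proof.
move=> c0 h; rewrite [leLHS]/Num.Def.normr/= mx_normrE.
by apply: bigmax_le => // -[i j] _ /=; rewrite ord1.
Qed.

Lemma hpartK (R : realType) (n : nat) (x : 'rV[R]_n) t : hpart (pt x t) = x.
Proof. by apply/rowP => j; rewrite !mxE liftK. Qed.

Lemma vcoordK (R : realType) (n : nat) (x : 'rV[R]_n) t : vcoord (pt x t) = t.
Proof. by rewrite /vcoord mxE unlift_none. Qed.

Lemma ptK (R : realType) (n : nat) (y : 'rV[R]_n.+1) :
  pt (hpart y) (vcoord y) = y.
Proof.
apply/rowP => i; rewrite mxE; case: unliftP => [j ->|->] //.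
by rewrite mxE.
Qed.

Lemma hpartB (R : realType) (n : nat) (x y : 'rV[R]_n.+1) :
  hpart (x - y) = hpart x - hpart y.
Proof. by apply/rowP => j; rewrite !mxE. Qed.

Lemma vcoordB (R : realType) (n : nat) (x y : 'rV[R]_n.+1) :
  vcoord (x - y) = vcoord x - vcoord y.
Proof. by rewrite /vcoord !mxE. Qed.

Lemma hpartD (R : realType) (n : nat) (x y : 'rV[R]_n.+1) :
  hpart (x + y) = hpart x + hpart y.
Proof. by apply/rowP => j; rewrite !mxE. Qed.

Lemma vcoordD (R : realType) (n : nat) (x y : 'rV[R]_n.+1) :
  vcoord (x + y) = vcoord x + vcoord y.
Proof. by rewrite /vcoord !mxE. Qed.

Lemma hpart0 (R : realType) (n : nat) : hpart (0 : 'rV[R]_n.+1) = 0.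
Proof. by apply/rowP => j; rewrite !mxE. Qed.

Lemma vcoord0 (R : realType) (n : nat) : vcoord (0 : 'rV[R]_n.+1) = 0.
Proof. by rewrite /vcoord mxE. Qed.

(** * Horizontal and vertical moves of the slab *)

(** The maximum norm on the horizontal part lets a vector-valued map be extended coordinate by
    coordinate with no loss; the sum keeps the estimates of both kinds of move linear. *)
Definition hvnorm {R : realType} {n : nat} (y : 'rV[R]_n.+1) : R :=
  `|hpart y| + `|vcoord y|.

Definition hvbilip {R : realType} {n : nat} (C : R)
    (F : 'rV[R]_n.+1 -> 'rV[R]_n.+1) : Prop :=
  forall x y, hvnorm (F x - F y) <= C * hvnorm (x - y) /\
    hvnorm (x - y) <= C * hvnorm (F x - F y).

Lemma hvnorm_ge0 (R : realType) (n : nat) (y : 'rV[R]_n.+1) : 0 <= hvnorm y.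
Proof. by rewrite addr_ge0. Qed.

Lemma hvbilip_comp (R : realType) (n : nat) (C D : R)
    (F G : 'rV[R]_n.+1 -> 'rV[R]_n.+1) :
  0 <= C -> 0 <= D -> hvbilip C F -> hvbilip D G -> hvbilip (C * D) (F \o G).
Proof.
move=> C0 D0 hF hG x y /=; have [f1 f2] := hF (G x) (G y).
have [g1 g2] := hG x y; split.
  by apply: (le_trans f1); rewrite -mulrA ler_wpM2l.
by apply: (le_trans g2); rewrite (mulrC C) -mulrA ler_wpM2l.
Qed.

(** Each coordinate of the displacement is extended with gauge [2^-1 * |dx| + K * |dt|]. The factor
    1/2 makes the move invertible at a fixed height: for an extended displacement [U], |dx| <= |dx +
    dU| + |dx|/2 + K |dt|, hence |dx| <= 2 |dx + dU| + 2 K |dt|. *)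
Lemma horizontal_move (R : realType) (n : nat) (J : Type) (D : set J) (a b K : R)
    (X X' : J -> 'rV[R]_n) (T : J -> R) :
  0 <= K ->
  (forall i j, D i -> D j -> `|(X' i - X i) - (X' j - X j)| <=
     2^-1 * `|X i - X j| + K * `|T i - T j|) ->
  (forall i, D i -> a <= T i <= b /\
     `|X' i - X i| <= K * (T i - a) /\ `|X' i - X i| <= K * (b - T i)) ->
  exists F : 'rV[R]_n.+1 -> 'rV[R]_n.+1, hvbilip (2 + 2 * K) F /\
    (forall y, vcoord y <= a \/ b <= vcoord y -> F y = y) /\
    (forall i, D i -> F (pt (X i) (T i)) = pt (X' i) (T i)).
Proof.
move=> K0 hIn hOut.
pose G (y : 'rV[R]_n.+1) : R := 2^-1 * `|hpart y| + K * `|vcoord y|.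
(* The data and the condition of being the identity off the slab are prescribed together: a point
   off the slab is its own index, with displacement 0. *)
pose E : set ('rV[R]_n.+1 + J) := [set i | match i with
  | inl y => vcoord y <= a \/ b <= vcoord y | inr j => D j end].
pose pos (i : 'rV[R]_n.+1 + J) := match i with
  | inl y => y | inr j => pt (X j) (T j) end.
pose w k (i : 'rV[R]_n.+1 + J) : R := match i with
  | inl y => 0 | inr j => (X' j - X j) 0 k end.
have GN y : G (- y) = G y.
  by rewrite -[- y]sub0r /G hpartB vcoordB hpart0 vcoord0 !sub0r !normrN.
have hout y i : vcoord y <= a \/ b <= vcoord y -> D i ->
    `|X' i - X i| <= G (pt (X i) (T i) - y).
  move=> hy Di; have [/andP[aT Tb] [h1 h2]] := hOut i Di.
  rewrite /G vcoordB vcoordK.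
  have : 0 <= 2^-1 * `|hpart (pt (X i) (T i) - y)| by rewrite mulr_ge0.
  have : `|X' i - X i| <= K * `|T i - vcoord y|; last by lra.
  case: hy => hy; [apply: (le_trans h1)|apply: (le_trans h2)]; apply: ler_wpM2l => //.
    by apply: le_trans (ler_norm _); lra.
  by rewrite distrC; apply: le_trans (ler_norm _); lra.
have /choice[u hu] : forall k : 'I_n, exists phi : 'rV[R]_n.+1 -> R,
    (forall i, E i -> phi (pos i) = w k i) /\
    forall x y, phi x - phi y <= G (x - y).
  move=> k; apply: mcshane.
  - by rewrite /G hpart0 vcoord0 !normr0 !mulr0 addr0.
  - move=> x y; rewrite /G hpartD vcoordD.
    have := ler_wpM2l K0 (ler_normD (vcoord x) (vcoord y)).
    have := ler_normD (hpart x) (hpart y); lra.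
  - by exists (inl (pt 0 b)); right; rewrite vcoordK.
  - move=> [y|i] [y'|j] /= Di Dj.
    + by rewrite subr0 addr_ge0 ?mulr_ge0.
    + rewrite sub0r -GN opprB; apply: le_trans _ (hout _ _ Di Dj).
      by rewrite (le_trans (ler_norm _))// normrN mxnorm_ge.
    + rewrite subr0; apply: le_trans _ (hout _ _ Dj Di).
      by rewrite (le_trans (ler_norm _))// mxnorm_ge.
    + rewrite /G hpartB vcoordB !hpartK !vcoordK.
      apply: le_trans _ (hIn _ _ Di Dj); apply: (le_trans (ler_norm _)).
      by apply: le_trans _ (mxnorm_ge _ _ _ k); rewrite !mxE.
pose U y : 'rV[R]_n := \row_k u k y.
have UG x y : `|U x - U y| <= G (x - y).
  apply: mxnorm_le => [|k]; first by rewrite addr_ge0 ?mulr_ge0.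
  rewrite !mxE ler_norml; have [_ h] := hu k.
  by have := h y x; rewrite -GN opprB; have := h x y; lra.
exists (fun y => pt (hpart y + U y) (vcoord y)); split; last split.
- move=> x y; rewrite /hvnorm !hpartB !vcoordB !hpartK !vcoordK.
  have := UG x y; rewrite /G hpartB vcoordB.
  set dx := hpart x - hpart y; set dt := vcoord x - vcoord y.
  rewrite opprD addrACA -/dx; set du := U x - U y => hdu.
  have h1 := ler_normD dx du.
  have h2 : `|dx| <= `|dx + du| + `|du|.
    by have := ler_normB (dx + du) du; rewrite addrK.
  have := normr_ge0 dx; have := normr_ge0 dt; have := normr_ge0 (dx + du).
  move: `|dx| `|dt| `|du| `|dx + du| hdu h1 h2 => p q r s h0 h1 h2 s0 q0 p0.
  have := mulr_ge0 K0 q0; have := mulr_ge0 K0 p0; have := mulr_ge0 K0 s0.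
  by split; nra.
- move=> y hy; rewrite -[RHS]ptK; congr pt.
  suff -> : U y = 0 by rewrite addr0.
  apply/rowP => k; rewrite !mxE; have [h _] := hu k.
  by rewrite -[y]/(pos (inl y)) h.
- move=> i Di; rewrite hpartK vcoordK; congr pt.
  apply/rowP => k; rewrite !mxE; have [h _] := hu k.
  by rewrite -[pt (X i) (T i)]/(pos (inr i)) h //= !mxE; ring.
Qed.

(** Here the new height itself is extended, with slopes between [l] and [l^-1] on vertical lines, so
    displacements need not be small. The last hypothesis imposes the same slope bounds between a
    data point and the two bounding planes. *)
Lemma vertical_move (R : realType) (n : nat) (J : Type) (D : set J) (a b K l : R)
    (X : J -> 'rV[R]_n) (T T' : J -> R) :
  0 <= K -> 0 < l -> l <= 1 ->
  (forall i j, D i -> D j -> T' i - T' j <=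
     K * `|X i - X j| + Num.max (l^-1 * (T i - T j)) (l * (T i - T j))) ->
  (forall i, D i -> l * (b - T i) <= b - T' i /\ l * (b - T' i) <= b - T i /\
     l * (T i - a) <= T' i - a /\ l * (T' i - a) <= T i - a) ->
  exists F : 'rV[R]_n.+1 -> 'rV[R]_n.+1, hvbilip ((1 + K + l^-1) * l^-1) F /\
    (forall y, vcoord y <= a \/ b <= vcoord y -> F y = y) /\
    (forall i, D i -> F (pt (X i) (T i)) = pt (X i) (T' i)).
Proof.
move=> K0 l0 l1 hIn hOut.
have li1 : 1 <= l^-1 by rewrite invf_ge1.
have lil : l^-1 * l = 1 by rewrite mulVf ?gt_eqF.
(* phi y - phi y' <= K |dx| + g (dt) says, on vertical lines, that phi increases
   with slopes between l and 1/l. *)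
pose g (s : R) : R := Num.max (l^-1 * s) (l * s).
have g1 s : l^-1 * s <= g s by rewrite le_max lexx.
have g2 s : l * s <= g s by rewrite le_max lexx orbT.
have gle s c : l^-1 * s <= c -> l * s <= c -> g s <= c.
  by move=> h1 h2; rewrite ge_max h1 h2.
pose G (y : 'rV[R]_n.+1) : R := K * `|hpart y| + g (vcoord y).
pose E : set ('rV[R]_n.+1 + J) := [set i | match i with
  | inl y => vcoord y <= a \/ b <= vcoord y | inr j => D j end].
pose pos (i : 'rV[R]_n.+1 + J) := match i with
  | inl y => y | inr j => pt (X j) (T j) end.
pose w (i : 'rV[R]_n.+1 + J) : R := match i with
  | inl y => vcoord y | inr j => T' j end.
have lmul (s c : R) : l * s <= c -> s <= l^-1 * c.
  by move=> h; rewrite mulrC ler_pdivlMr // mulrC.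
have [phi [hphi phiG]] : exists phi : 'rV[R]_n.+1 -> R,
    (forall i, E i -> phi (pos i) = w i) /\
    forall x y, phi x - phi y <= G (x - y).
  apply: mcshane.
  - by rewrite /G hpart0 vcoord0 /g !mulr0 normr0 mulr0 maxxx addr0.
  - move=> x y; rewrite /G hpartD vcoordD.
    have := ler_wpM2l K0 (ler_normD (hpart x) (hpart y)).
    have : g (vcoord x + vcoord y) <= g (vcoord x) + g (vcoord y).
      by apply: gle; rewrite mulrDr lerD.
    lra.
  - by exists (inl (pt 0 b)); right; rewrite vcoordK.
  - move=> [y|i] [y'|j] /= Di Dj; rewrite /G ?hpartB ?vcoordB ?hpartK ?vcoordK.
    + apply: ler_wpDl; first exact: mulr_ge0.
      have [s0|s0] := leP 0 (vcoord y - vcoord y').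
        by apply: le_trans (g1 _); nra.
      by apply: le_trans (g2 _); nra.
    + apply: ler_wpDl; first exact: mulr_ge0.
      have [h1 [h2 [h3 h4]]] := hOut j Dj; case: Di => hy.
        by apply: le_trans (g2 _); nra.
      by apply: le_trans (g1 _); apply: lmul; nra.
    + apply: ler_wpDl; first exact: mulr_ge0.
      have [h1 [h2 [h3 h4]]] := hOut i Di; case: Dj => hy.
        by apply: le_trans (g1 _); apply: lmul; nra.
      by apply: le_trans (g2 _); nra.
    + exact: hIn.
exists (fun y => pt (hpart y) (phi y)); split; last split.
(* For ordered heights, [phiG] used in both directions traps the increment of [phi] between l dt - K
   |dx| and dt / l + K |dx|; the lower bound recovers dt. *)
- have mono x y : vcoord y <= vcoord x ->
      hvnorm (pt (hpart x) (phi x) - pt (hpart y) (phi y)) <=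
        (1 + K + l^-1) * l^-1 * hvnorm (x - y) /\
      hvnorm (x - y) <= (1 + K + l^-1) * l^-1 *
        hvnorm (pt (hpart x) (phi x) - pt (hpart y) (phi y)).
    move=> xy; rewrite /hvnorm !hpartB !vcoordB !hpartK !vcoordK.
    have := phiG x y; have := phiG y x; rewrite /G !hpartB !vcoordB.
    rewrite (distrC (hpart y)).
    have := normr_ge0 (hpart x - hpart y).
    have s0 : 0 <= vcoord x - vcoord y by lra.
    rewrite (ger0_norm s0) -(opprB (vcoord x)).
    move: `|hpart x - hpart y| (vcoord x - vcoord y) s0 => p q q0 p0.
    have -> : g (- q) = - (l * q).
      by rewrite /g !mulrN; apply: max_r; rewrite lerN2; nra.
    have -> : g q = l^-1 * q by rewrite /g; apply: max_l; nra.
    move=> h1 h2.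
    have : `|phi x - phi y| <= K * p + l^-1 * q.
      by rewrite ler_norml; apply/andP; split; nra.
    have : q <= l^-1 * (K * p + `|phi x - phi y|).
      by apply: lmul; have := ler_norm (phi x - phi y); lra.
    have := normr_ge0 (phi x - phi y).
    move: `|phi x - phi y| (l^-1) li1 => r m m1 r0 hq hr.
    have Kp := mulr_ge0 K0 p0; have Kq := mulr_ge0 K0 q0; have Kr := mulr_ge0 K0 r0.
    have m0 : 0 <= m - 1 by lra.
    have h0 : 0 <= (1 + K + m) * (p + q) by apply: mulr_ge0; lra.
    have := mulr_ge0 m0 h0; have := mulr_ge0 m0 p0; have := mulr_ge0 m0 r0.
    have := mulr_ge0 m0 Kr; have := mulr_ge0 m0 Kp; have := mulr_ge0 m0 q0.
    have := mulr_ge0 m0 (mulr_ge0 m0 p0); have := mulr_ge0 m0 (mulr_ge0 m0 r0).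
    move=> i1 i2 i3 i4 i5 i6 i7 i8; split; nra.
  move=> x y; have [xy|yx] := leP (vcoord y) (vcoord x); first exact: mono.
  have NN (z : 'rV[R]_n.+1) : hvnorm (- z) = hvnorm z.
    by rewrite -[- z]sub0r /hvnorm hpartB vcoordB hpart0 vcoord0 !sub0r !normrN.
  rewrite -(NN (x - y)) -(NN (pt _ _ - _)) !opprB; exact: mono (ltW yx).
- move=> y hy; rewrite -[RHS]ptK; congr pt.
  by rewrite -[y]/(pos (inl y)) hphi.
- move=> i Di; rewrite hpartK; congr pt.
  by rewrite -[pt (X i) (T i)]/(pos (inr i)) hphi.
Qed.

(** * Colouring the integer lattice and rounding to grid cosets *)

Lemma row_neq (n : nat) (z z' : 'rV[int]_n) : z <> z' -> exists j, z 0 j != z' 0 j.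
Proof.
move=> zz'; apply/existsP; rewrite -negb_forall; apply/negP => /forallP h.
by apply: zz'; apply/rowP => j; apply/eqP.
Qed.

(** The colour numbers the vector of residues modulo [N]; distinct points of one colour differ in
    some coordinate by a nonzero multiple of [N]. *)
Lemma residue_index (n N : nat) : (0 < N)%N ->
  exists c : 'rV[int]_n -> nat, (forall z, (c z < N ^ n)%N) /\
    forall z z', c z = c z' -> z <> z' ->
      exists j, N%:Z <= `|z 0 j - z' 0 j|.
Proof.
case: N => // N _.
pose r (z : 'rV[int]_n) : {ffun 'I_n -> 'I_N.+1} :=
  [ffun j => inord (absz (modz (z 0%R j) N.+1%:Z))].
exists (fun z => nat_of_ord (enum_rank (r z))); split=> [z|z z' /val_inj/enum_rank_inj rE zz'].
  by have := ltn_ord (enum_rank (r z)); rewrite [X in (_ < X)%N]card_ffun !card_ord.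
have [j zj] := row_neq _ _ _ zz'.
exists j; have /ffunP/(_ j) := rE; rewrite !ffunE => /(congr1 val).
have lt (x : int) : (absz (x %% N.+1%:Z)%Z < N.+1)%N.
  by have := @ltz_mod x N.+1%:Z isT; have := @modz_ge0 x N.+1%:Z isT; lia.
rewrite /= !inordK // => e.
have : (N.+1%:Z %| (z 0 j - z' 0 j)%R)%Z.
  rewrite -eqz_mod_dvd; apply/eqP.
  have := @modz_ge0 (z 0 j) N.+1%:Z isT.
  by have := @modz_ge0 (z' 0 j) N.+1%:Z isT; lia.
move=> /dvdzP[k kE]; rewrite kE normrM.
have k0 : k <> 0 by move=> k0; move: zj; rewrite -subr_eq0 kE k0 mul0r eqxx.
by nia.
Qed.

Lemma int_sep (R : realType) (a b : int) : a <> b -> 1 <= `|a%:~R - b%:~R| :> R.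
Proof.
move=> ab; rewrite -intrB -intr_norm -[1]/(1%:~R) ler_int.
by lia.
Qed.

Lemma rowBE (R : realType) (n : nat) (u v : 'rV[R]_n) j :
  (u - v) 0 j = u 0 j - v 0 j.
Proof. by rewrite !mxE. Qed.

Lemma zrB_ge (R : realType) (n : nat) (z z' : 'rV[int]_n) j :
  `|z 0 j - z' 0 j|%:~R <= `|zr z - zr z'| :> R.
Proof.
by apply: le_trans _ (mxnorm_ge _ _ _ j); rewrite !mxE -intrB intr_norm.
Qed.

Lemma zr_sep (R : realType) (n : nat) (z z' : 'rV[int]_n) :
  z <> z' -> 1 <= `|zr z - zr z'| :> R.
Proof.
move=> /row_neq[j zj].
apply: le_trans (zrB_ge _ _ _ _ j); rewrite -[1]/(1%:~R) ler_int.
by move/eqP: zj; lia.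
Qed.

(** The grid of mesh r/m splits into m cosets, each of mesh r, so every coset has a point within r
    of x. *)
Lemma snap (R : realType) (m i : nat) (r x : R) : 0 < r -> (i < m)%N ->
  exists A : int, `|r / m%:R * A%:~R - x| <= r /\
    exists b : int, A = m%:Z * b + i%:Z.
Proof.
move=> r0 im; pose b := Num.floor (x / r); exists (m%:Z * b + i%:Z).
split; last by exists b.
have m0 : 0 < m%:R :> R by rewrite ltr0n; lia.
have iR : i%:R <= m%:R :> R by rewrite ler_nat ltnW.
rewrite intrD intrM -!pmulrn.
have -> : r / m%:R * (m%:R * b%:~R + i%:R) - x = r * b%:~R - x + r * (i%:R / m%:R).
  by field; rewrite gt_eqF.
have i0 : 0 <= i%:R / m%:R :> R by rewrite divr_ge0.
have i1 : i%:R / m%:R <= 1 :> R by rewrite ler_pdivrMr // mul1r.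
have /andP[] : b%:~R <= x / r < (b + 1)%:~R by rewrite floor_itv.
rewrite intrD ler_pdivlMr // ltr_pdivrMr // => h1 h2.
by rewrite ler_norml; apply/andP; split; nra.
Qed.

Lemma code_inj (P k k' c c' : nat) : (c < P)%N -> (c' < P)%N ->
  (P * k + c = P * k' + c')%N -> k = k' /\ c = c'.
Proof.
move=> cP c'P e; have kk' : k = k'.
  have := congr1 (divn^~ P) e; rewrite !(mulnC P) !divnMDl; try lia.
  by rewrite !divn_small // !addn0.
by split=> //; subst; lia.
Qed.

(** * Composition of the four moves *)

(** [M] bounds the horizontal displacement, [s] the separation of the targets, [eta] their distance
    to the bounding planes. The factors of the constant, from right to left, belong to the moves in
    order of application. The horizontal dimension [n.+1] is positive, so there is a coordinate to
    round. *)
Lemma layers_to_points (R : realType) (n H N : nat) (M s eta : R)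
    (q : 'rV[int]_n.+1 -> nat -> 'rV[R]_n.+2) :
  (0 < H)%N -> 0 <= M -> 4 * (M + 1) <= N%:R -> 0 < s -> s <= 1 ->
  0 < eta -> eta <= 4^-1 -> s <= 8 * eta ->
  (forall z k, (1 <= k <= H)%N -> `|hpart (q z k) - zr z| <= M) ->
  (forall z k, (1 <= k <= H)%N ->
     2^-1 + eta <= vcoord (q z k) <= H%:R + 2^-1 - eta) ->
  (forall z k z' k', (1 <= k <= H)%N -> (1 <= k' <= H)%N -> (z, k) <> (z', k') ->
     s <= `|hpart (q z k) - hpart (q z' k')| \/
     s <= `|vcoord (q z k) - vcoord (q z' k')|) ->
  exists F : 'rV[R]_n.+2 -> 'rV[R]_n.+2,
    hvbilip (4 * ((1 + 16 * N%:R ^+ n.+1 * H%:R ^+ 2 / s + H%:R / eta) * (H%:R / eta))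
             * (2 + 16 * N%:R ^+ n.+1 * (M + 1)) * 8) F /\
    (forall y, vcoord y <= 2^-1 \/ H%:R + 2^-1 <= vcoord y -> F y = y) /\
    (forall z k, (1 <= k <= H)%N -> F (pt (zr z) k%:R) = q z k).
Proof.
move=> H0 M0 NM s0 s1 eta0 eta1 seta hM hV hs.
have N0 : (0 < N)%N by rewrite -(ltr0n R); lra.
have [c [cP cN]] := residue_index n.+1 N N0.
pose Pn := (N ^ n.+1)%N; pose P : R := N%:R ^+ n.+1.
have PE : Pn%:R = P by rewrite /P natrX.
have Pn0 : (0 < Pn)%N by rewrite expn_gt0 N0.
have P0 : 0 < P by rewrite -PE ltr0n.
have P1 : 1 <= P by rewrite -PE ler1n.
have H1 : 1 <= H%:R :> R by rewrite ler1n.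
pose D : set ('rV[int]_n.+1 * nat) := [set p | (1 <= p.2 <= H)%N].
have DH p : D p -> 1 <= (p.2%:R : R) <= H%:R.
  by move=> /= /andP[h1 h2]; rewrite ler1n h1 ler_nat h2.
pose Z (p : 'rV[int]_n.+1 * nat) : 'rV[R]_n.+1 := zr p.1.
pose x (p : 'rV[int]_n.+1 * nat) := hpart (q p.1 p.2).
pose y (p : 'rV[int]_n.+1 * nat) := vcoord (q p.1 p.2).
(* The lift stays below 1/4. Multiplied by 4P, the heights become integers 4Pk + c with c < P, which
   determine the colour; so distinct colours lie at least 1/(4P) apart in height. *)
pose f (p : 'rV[int]_n.+1 * nat) : R := (c p.1)%:R / (4 * P).
have f0 p : 0 <= f p by rewrite divr_ge0 // mulr_ge0 // ltW.
have f1 p : f p <= 4^-1.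
  rewrite ler_pdivrMr ?mulr_gt0 // mulrA mulVf ?mul1r // -PE ler_nat.
  exact: ltnW.
pose tau (p : 'rV[int]_n.+1 * nat) : R := p.2%:R + f p.
have tau_sep p p' : (c p.1, p.2) <> (c p'.1, p'.2) ->
    1 <= (4 * P) * `|tau p - tau p'|.
  move=> pp'; have nz : P != 0 by rewrite gt_eqF.
  rewrite -{1}(@ger0_norm _ (4 * P)) ?mulr_ge0 ?(ltW P0) // -normrM.
  have -> : 4 * P * (tau p - tau p') = (4 * Pn * p.2 + c p.1)%N%:~R -
      (4 * Pn * p'.2 + c p'.1)%N%:~R.
    rewrite -!pmulrn !natrD !natrM PE /tau /f; field.
    by rewrite nz.
  apply: int_sep => -[e]; apply: pp'.
  have := cP p.1; have := cP p'.1; rewrite -/Pn => l1 l2.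
  have /code_inj[|| -> ->] // := e; exact: leq_trans (leq_pmull _ _).
(* Rounding costs at most s/8, and [m] counts the colours; [i] numbers them from 0, whence the
   predecessor of the layer. *)
pose rho0 : R := s / 8; pose m := (Pn * H)%N.
have rho00 : 0 < rho0 by rewrite /rho0; lra.
pose i (p : 'rV[int]_n.+1 * nat) := (Pn * p.2.-1 + c p.1)%N.
have im p : D p -> (i p < m)%N.
  move=> /= /andP[d1 d2]; apply: (@leq_trans (Pn * p.2.-1 + Pn)).
    by rewrite ltn_add2l cP.
  by rewrite -mulnSr leq_mul2l prednK // d2 orbT.
have /choice[A hA] : forall p, exists A : int, D p ->
    `|rho0 / m%:R * A%:~R - x p 0 0| <= rho0 /\ exists b : int, A = m%:Z * b + (i p)%:Z.
  move=> p; have [Dp|Dp] := pselect (D p); last by exists 0.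
  by have [A hA] := snap R m (i p) rho0 (x p 0 0) rho00 (im p Dp); exists A.
pose X (p : 'rV[int]_n.+1 * nat) : 'rV[R]_n.+1 :=
  \row_j if j == 0 then rho0 / m%:R * (A p)%:~R else x p 0 j.
have XE p j : X p 0 j = if j == 0 then rho0 / m%:R * (A p)%:~R else x p 0 j.
  by rewrite mxE.
have Xx p : D p -> `|X p - x p| <= s / 8.
  move=> Dp; apply: mxnorm_le => [|j]; first by rewrite ltW.
  rewrite rowBE XE; have [->|_] := eqVneq j 0; first by case: (hA p Dp).
  by rewrite subrr normr0 ltW.
have m0 : 0 < m%:R :> R by rewrite ltr0n muln_gt0 Pn0.
have rho1 : 0 < rho0 / m%:R by rewrite divr_gt0.
have XZ p : D p -> `|X p - Z p| <= M + 1.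
  move=> Dp; have := Xx p Dp; have := hM p.1 p.2 Dp; rewrite -/(x p) -/(Z p) => h1 h2.
  have := ler_normD (X p - x p) (x p - Z p); rewrite addrA subrK; lra.
have same p p' : (c p.1, p.2) = (c p'.1, p'.2) -> p <> p' ->
    4 * (M + 1) <= `|Z p - Z p'|.
  move=> [e1 e2] pp'; have [j hj] : exists j, N%:Z <= `|p.1 0 j - p'.1 0 j|.
    by apply: cN => // e; apply: pp'; case: (p) (p') e e2 => [? ?] [? ?] /= -> ->.
  apply: le_trans (zrB_ge _ _ _ _ j); apply: (le_trans NM).
  by rewrite pmulrn ler_int.
have rho_small : rho0 / m%:R <= 1.
  rewrite ler_pdivrMr // mul1r (@le_trans _ _ 1) ?ler1n ?muln_gt0 ?Pn0 //.
  by rewrite /rho0; lra.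
(* Within a colour the lattice points are 4(M + 1) apart and each moves by at most M + 1. Between
   colours the rounded coordinates lie in different cosets of the grid. *)
have X_sep p p' : D p -> D p' -> p <> p' -> rho0 / m%:R <= `|X p - X p'|.
  move=> Dp Dp' pp'.
  have [e|ne] := pselect ((c p.1, p.2) = (c p'.1, p'.2)).
    have := same _ _ e pp'; have := XZ p Dp; have := XZ p' Dp'.
    have := ler_normD (Z p - X p) (X p - X p').
    have := ler_normD (Z p - X p + (X p - X p')) (X p' - Z p').
    rewrite (distrC (Z p) (X p)) !addrA subrK subrK; lra.
  apply: le_trans _ (mxnorm_ge _ _ _ 0); rewrite rowBE !XE /=.
  rewrite -mulrBr normrM (gtr0_norm rho1) ler_peMr ?(ltW rho1) //.
  apply: int_sep => e; apply: ne.
  have [_ [b bE]] := hA p Dp; have [_ [b' bE']] := hA p' Dp'.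
  have : i p = i p'.
    move: e; rewrite bE bE' ![m%:Z * _]mulrC => /(congr1 (modz^~ m%:Z)).
    by rewrite !modzMDl !modz_small ?ltz_nat ?im //; case.
  move: (cP p.1) (cP p'.1); rewrite -/Pn /i => l1 l2 /(code_inj _ _ _ _ _ l1 l2).
  move=> [e1 ->]; congr pair.
  move: Dp Dp' => /andP[d1 _] /andP[d1' _].
  by rewrite -(prednK d1) e1 prednK.
have [F1 [hF1 [out1 e1]]] : exists F : 'rV[R]_n.+2 -> 'rV[R]_n.+2,
    hvbilip 8 F /\
    (forall y, vcoord y <= 2^-1 \/ H%:R + 2^-1 <= vcoord y -> F y = y) /\
    (forall p, D p -> F (pt (Z p) p.2%:R) = pt (Z p) (tau p)).
  (* Here K = 1 and l = 1/2: points on one vertical line get the same lift, and lifts over distinct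
     lattice points differ by at most 1/4. *)
  have -> : 8 = (1 + 1 + 2^-1^-1) * 2^-1^-1 :> R by field.
  apply: vertical_move; [lra|lra|lra| |].
    move=> p p' Dp Dp'; rewrite /tau.
    have g1 : p.2%:R - p'.2%:R <= Num.max (2^-1^-1 * (p.2%:R - p'.2%:R))
        (2^-1 * (p.2%:R - p'.2%:R)) :> R.
      rewrite le_max invrK; apply/orP.
      by have [|] := leP 0 (p.2%:R - p'.2%:R : R); [left|right]; lra.
    have [e|ne] := pselect (p.1 = p'.1).
      by rewrite /f /Z e subrr normr0; lra.
    have := zr_sep R _ _ _ ne; have := f0 p; have := f1 p; have := f0 p'.
    have := f1 p'; rewrite -/(Z p) -/(Z p'); lra.
  move=> p Dp; have := f0 p; have := f1 p; have := DH p Dp; rewrite /tau.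
  by move=> /andP[? ?] ? ?; do !split; lra.
have tau_in p : D p -> 2^-1 + 4^-1 <= tau p <= H%:R + 2^-1 - 4^-1.
  by move=> Dp; have := DH p Dp; have := f0 p; have := f1 p; rewrite /tau; lra.
have y_in p : D p -> 2^-1 + eta <= y p <= H%:R + 2^-1 - eta by exact: hV.
(* Two displacements differ by at most 2(M + 1). Within a colour, half of the distance 4(M + 1)
   covers this; between colours the height gap 1/(4P) does, with K = 8P(M + 1). *)
have [F2 [hF2 [out2 e2]]] : exists F : 'rV[R]_n.+2 -> 'rV[R]_n.+2,
    hvbilip (2 + 2 * (8 * P * (M + 1))) F /\
    (forall y, vcoord y <= 2^-1 \/ H%:R + 2^-1 <= vcoord y -> F y = y) /\
    (forall p, D p -> F (pt (Z p) (tau p)) = pt (X p) (tau p)).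
  have PM : M + 1 <= P * (M + 1) by rewrite ler_peMl //; lra.
  apply: horizontal_move; first by rewrite !mulr_ge0 //; lra.
    move=> p p' Dp Dp'.
    have [->|pp'] := pselect (p = p').
      by rewrite !subrr !normr0 !mulr0 addr0.
    apply: (@le_trans _ _ (2 * (M + 1))).
      have := ler_normB (X p - Z p) (X p' - Z p').
      by have := XZ p Dp; have := XZ p' Dp'; lra.
    have h0 : 0 <= `|tau p - tau p'| by [].
    have [e|ne] := pselect ((c p.1, p.2) = (c p'.1, p'.2)).
      have := same _ _ e pp'.
      have : 0 <= 8 * P * (M + 1) * `|tau p - tau p'| by rewrite !mulr_ge0 //; lra.
      lra.
    have h1 := tau_sep _ _ ne; have : 0 <= 2^-1 * `|Z p - Z p'| by rewrite mulr_ge0.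
    have : 2 * (M + 1) * 1 <= 2 * (M + 1) * (4 * P * `|tau p - tau p'|).
      by apply: ler_wpM2l => //; lra.
    lra.
  move=> p Dp; have := tau_in p Dp; have := XZ p Dp => h /andP[t1 t2].
  do !split; [lra| |].
    apply: (le_trans h); apply: (@le_trans _ _ (8 * P * (M + 1) * 4^-1)); first lra.
    by apply: ler_wpM2l; [rewrite !mulr_ge0 //|]; lra.
  apply: (le_trans h); apply: (@le_trans _ _ (8 * P * (M + 1) * 4^-1)); first lra.
  by apply: ler_wpM2l; [rewrite !mulr_ge0 //|]; lra.
have [F3 [hF3 [out3 e3]]] : exists F : 'rV[R]_n.+2 -> 'rV[R]_n.+2,
    hvbilip ((1 + 16 * P * H%:R ^+ 2 / s + H%:R / eta) * (H%:R / eta)) F /\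
    (forall y, vcoord y <= 2^-1 \/ H%:R + 2^-1 <= vcoord y -> F y = y) /\
    (forall p, D p -> F (pt (X p) (tau p)) = pt (X p) (y p)).
  (* All heights lie in a slab of thickness H, at least [eta] from its boundary, which gives the
     slope eta/H. *)
  have -> : H%:R / eta = (eta / H%:R)^-1 by rewrite invf_div.
  have l0 : 0 < eta / H%:R by rewrite divr_gt0 //; lra.
  have l1 : eta / H%:R <= 1 by rewrite ler_pdivrMr; lra.
  have lH : eta / H%:R * H%:R = eta by rewrite divfK // gt_eqF //; lra.
  have K0 : 0 <= 16 * P * H%:R ^+ 2 / s by rewrite divr_ge0 // ?mulr_ge0 //; lra.
  (* K is chosen so that the least separation of the rounded points contributes 2H, more than any
     height difference to be realized. *)
  have Krho : 16 * P * H%:R ^+ 2 / s * (rho0 / m%:R) = 2 * H%:R.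
    rewrite /rho0 /m natrM PE; field.
    by rewrite !gt_eqF //; lra.
  apply: vertical_move => //.
    move=> p p' Dp Dp'; have [->|pp'] := pselect (p = p').
      by rewrite !subrr normr0 !mulr0 maxxx addr0.
    have := X_sep p p' Dp Dp' pp' => /(ler_wpM2l K0); rewrite Krho => h.
    have : eta / H%:R * (tau p - tau p') <= Num.max ((eta / H%:R)^-1 * (tau p - tau p'))
       (eta / H%:R * (tau p - tau p')) by rewrite le_max lexx orbT.
    have /andP[t1 t2] := tau_in p Dp; have /andP[t3 t4] := tau_in p' Dp'.
    have /andP[y1 y2] := y_in p Dp; have /andP[y3 y4] := y_in p' Dp'.
    move: (Num.max _ _) => g.
    have : 0 <= eta / H%:R * (H%:R + tau p - tau p').
      by apply: mulr_ge0; [exact: ltW|lra].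
    move: (eta / H%:R) lH => l lH *; lra.
  move=> p Dp; have /andP[t1 t2] := tau_in p Dp; have /andP[y1 y2] := y_in p Dp.
  have lle u : u <= H%:R -> eta / H%:R * u <= eta.
    by move=> uH; rewrite -[leRHS]lH; apply: ler_wpM2l => //; exact: ltW.
  by do !split; apply: (@le_trans _ _ eta); [apply: lle| |apply: lle| |apply: lle|
    |apply: lle| ]; lra.
have [F4 [hF4 [out4 e4]]] : exists F : 'rV[R]_n.+2 -> 'rV[R]_n.+2,
    hvbilip 4 F /\
    (forall y, vcoord y <= 2^-1 \/ H%:R + 2^-1 <= vcoord y -> F y = y) /\
    (forall p, D p -> F (pt (X p) (y p)) = pt (x p) (y p)).
  (* Two roundings differ by at most s/4. If |x - x'| >= s, the rounded points are still 3s/4 apart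
     and half of that suffices; otherwise the heights differ by s and K = 1 suffices. *)
  have -> : 4 = 2 + 2 * 1 :> R by ring.
  apply: horizontal_move => //.
    move=> p p' Dp Dp'; rewrite mul1r; have [->|pp'] := pselect (p = p').
      by rewrite !subrr !normr0 !mulr0 addr0.
    have := ler_normB (x p - X p) (x p' - X p').
    have : `|x p - X p| <= s / 8 by rewrite distrC Xx.
    have : `|x p' - X p'| <= s / 8 by rewrite distrC Xx.
    have := normr_ge0 (X p - X p'); have := normr_ge0 (y p - y p').
    have := hs p.1 p.2 p'.1 p'.2 Dp Dp'; rewrite -!surjective_pairing => /(_ pp').
    rewrite -/(x p) -/(x p') -/(y p) -/(y p') => -[]; last lra.
    have := ler_normD (x p - X p) (X p - X p').
    have := ler_normB (x p - X p + (X p - X p')) (x p' - X p').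
    rewrite addrA subrK opprB addrA subrK; lra.
  move=> p Dp; rewrite !mul1r distrC; have := Xx p Dp; have /andP[y1 y2] := y_in p Dp.
  by move=> *; do !split; lra.
exists (F4 \o (F3 \o (F2 \o F1))); split; last split.
- set C3 := (1 + _ + _) * _.
  have C30 : 0 <= C3.
    by rewrite mulr_ge0 // ?addr_ge0 // ?divr_ge0 ?mulr_ge0 // ltW.
  have C20 : 0 <= 2 + 2 * (8 * P * (M + 1)).
    by rewrite addr_ge0 // !mulr_ge0 ?addr_ge0 // ltW.
  have h2 := hvbilip_comp R _ _ _ _ _ C20 (ler0n R 8) hF2 hF1.
  have h3 := hvbilip_comp R _ _ _ _ _ C30 (mulr_ge0 C20 (ler0n R 8)) hF3 h2.
  have h4 := hvbilip_comp R _ _ _ _ _ (ler0n R 4)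
    (mulr_ge0 C30 (mulr_ge0 C20 (ler0n R 8))) hF4 h3.
  rewrite -/P; congr (hvbilip _ _): h4; ring.
- by move=> v hv /=; rewrite out1 // out2 // out3 // out4.
- move=> z k kH /=; have Dp : D (z, k) by [].
  by rewrite (e1 _ Dp) (e2 _ Dp) (e3 _ Dp) (e4 _ Dp) ptK.
Qed.

(** * Comparison with the Euclidean norm *)

Lemma enorm_ge_coord (R : realType) (n : nat) (x : 'rV[R]_n) j :
  `|x 0 j| <= enorm x.
Proof.
rewrite -sqrtr_sqr ler_sqrt; last by apply: sumr_ge0 => i _; exact: sqr_ge0.
by rewrite (bigD1 j) //= lerDl; apply: sumr_ge0 => i _; exact: sqr_ge0.
Qed.

Lemma enorm_ge0 (R : realType) (n : nat) (x : 'rV[R]_n) : 0 <= enorm x.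
Proof. exact: sqrtr_ge0. Qed.

Lemma enorm_le_sum (R : realType) (n : nat) (x : 'rV[R]_n) :
  enorm x <= \sum_(i < n) `|x 0 i|.
Proof.
have s0 : 0 <= \sum_(i < n) `|x 0 i| by apply: sumr_ge0.
rewrite -(ger0_norm s0) -sqrtr_sqr ler_sqrt ?sqr_ge0 //.
have : forall s : seq 'I_n,
    \sum_(i <- s) x 0 i ^+ 2 <= (\sum_(i <- s) `|x 0 i|) ^+ 2; last by [].
elim=> [|i s IH]; first by rewrite !big_nil expr0n.
have h : 0 <= \sum_(i <- s) `|x 0 i| by apply: sumr_ge0.
rewrite !big_cons; have := normr_ge0 (x 0 i); rewrite -(real_normK (num_real (x 0 i))).
move: (`|x 0 i|) => u u0; nra.
Qed.

Lemma hvnorm_le_enorm (R : realType) (n : nat) (y : 'rV[R]_n.+1) :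
  hvnorm y <= 2 * enorm y.
Proof.
have : `|hpart y| <= enorm y.
  by apply: mxnorm_le => [|j]; [exact: enorm_ge0|rewrite mxE enorm_ge_coord].
have : `|vcoord y| <= enorm y := enorm_ge_coord _ _ _ _.
rewrite /hvnorm; lra.
Qed.

Lemma enorm_le_hpart_vcoord (R : realType) (n : nat) (y : 'rV[R]_n.+1) :
  enorm y <= n%:R * `|hpart y| + `|vcoord y|.
Proof.
apply: (le_trans (enorm_le_sum _ _ _)); rewrite (bigD1_ord ord_max) //= addrC.
have -> : n%:R * `|hpart y| = \sum_(j < n) `|hpart y|.
  by rewrite sumr_const card_ord mulr_natl.
rewrite lerD2r; apply: ler_sum => j _.
by apply: le_trans _ (mxnorm_ge _ _ _ j); rewrite mxE.
Qed.

Lemma enorm_le_hvnorm (R : realType) (n : nat) (y : 'rV[R]_n.+1) :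
  enorm y <= n.+1%:R * hvnorm y.
Proof.
apply: (le_trans (enorm_le_hpart_vcoord _ _ _)); rewrite /hvnorm mulrDr -natr1.
have := normr_ge0 (hpart y); have := normr_ge0 (vcoord y).
have := ler0n R n; nra.
Qed.

Lemma enorm_vertical (R : realType) (n : nat) (y : 'rV[R]_n.+1) :
  hpart y = 0 -> enorm y = `|vcoord y|.
Proof.
move=> h; apply/eqP; rewrite eq_le enorm_ge_coord andbT.
by apply: (le_trans (enorm_le_hpart_vcoord _ _ _)); rewrite h normr0 mulr0 add0r.
Qed.

Lemma bilip_hvbilip (R : realType) (n : nat) (C : R) (F : 'rV[R]_n.+1 -> 'rV[R]_n.+1) :
  0 <= C -> hvbilip C F -> bilip_on (2 * n.+1%:R * C) setT F.
Proof.
move=> C0 hF x y _ _; have [h1 h2] := hF x y.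
have key (u v : 'rV[R]_n.+1) : hvnorm u <= C * hvnorm v -> enorm u <= 2 * n.+1%:R * C * enorm v.
  move=> h; apply: (le_trans (enorm_le_hvnorm R n u)).
  rewrite (mulrC 2) -!mulrA; apply: ler_wpM2l => //; apply: (le_trans h).
  rewrite mulrCA; apply: ler_wpM2l => //; exact: hvnorm_le_enorm.
by split; apply: key.
Qed.

Lemma bilip_le (R : realType) (n : nat) (C D : R) (A : set 'rV[R]_n)
    (F : 'rV[R]_n -> 'rV[R]_n) :
  C <= D -> bilip_on C A F -> bilip_on D A F.
Proof.
move=> CD h x y Ax Ay; have [h1 h2] := h x y Ax Ay; split.
  by apply: (le_trans h1); apply: ler_wpM2r => //; exact: enorm_ge0.
by apply: (le_trans h2); apply: ler_wpM2r => //; exact: enorm_ge0.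
Qed.

(** * Block permutations and the exponential upper bound *)

(** The shift by 1/2 keeps integers off the faces of the closed cubes, so the blocks tile the
    lattice. *)
Lemma blockP (R : realType) (n S : nat) (z w : 'rV[int]_n) :
  block R n S z w <-> forall j, S%:Z * z 0 j <= w 0 j < S%:Z * z 0 j + S%:Z.
Proof.
have e1 (a b : int) : (- 2^-1 + a%:~R <= b%:~R :> R) <-> a <= b.
  split=> h; last by move: h; rewrite -(ler_int R); lra.
  by rewrite -ltzD1 -(ltr_int R) intrD; lra.
have e2 (a b : int) : (a%:~R <= - 2^-1 + b%:~R :> R) <-> a < b.
  split=> h; first by rewrite -(ltr_int R); lra.
  by move: h; rewrite -lezD1 -(ler_int R) intrD; lra.
have eS (a : int) : S%:R * a%:~R = (S%:Z * a)%:~R :> R by rewrite intrM pmulrn.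
split=> h j; have := h j; rewrite eS (pmulrn (1 : R) S) -addrA -intrD => hj.
  have [/e1 h1 /e2 h2] := hj; rewrite h1 /=; lia.
have /andP[h1 h2] := hj; split; [exact/e1|apply/e2; lia].
Qed.

Lemma block_cover (R : realType) (n S : nat) (w : 'rV[int]_n) : (0 < S)%N ->
  block R n S (\row_j (w 0%R j %/ S%:Z)%Z) w.
Proof.
move=> S0; apply/blockP => j; rewrite mxE.
have := divz_eq (w 0 j) S%:Z.
have := @modz_ge0 (w 0 j) S%:Z; have := @ltz_pmod (w 0 j) S%:Z.
move: (divz (w 0 j) S) (modz (w 0 j) S) => a r; lia.
Qed.

Lemma block_perm_displacement (R : realType) (n S : nat)
    (sigma : 'rV[int]_n -> 'rV[int]_n) w j : (0 < S)%N ->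
  block_perm R n S sigma -> `|sigma w 0 j - w 0 j| < S%:Z.
Proof.
move=> S0 [_ hs]; have hw := block_cover R n S w S0.
have [/(_ _ hw) hw' _] := hs (\row_j (w 0%R j %/ S%:Z)%Z).
move/blockP: hw => /(_ j); move/blockP: hw' => /(_ j); lia.
Qed.

Lemma block1_perm (R : realType) (n : nat) (sigma : 'rV[int]_n -> 'rV[int]_n) w :
  block_perm R n 1 sigma -> sigma w = w.
Proof.
move=> hs; apply/rowP => j.
by have := block_perm_displacement R n 1 sigma w j isT hs; lia.
Qed.

(** Bounding each factor by a power of 2 leaves 18 + (n+1) + 2(S+2)(n+1) + S <= 8(n+2)S, which holds
    once S >= 2. *)
Lemma permutation_cost (n S : nat) : (1 < S)%N ->
  (2 ^ 18 * n.+2 * ((4 * S.+1) ^ n.+1) ^ 2 * S.+1 <= 2 ^ (8 * n.+2 * S))%N.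
Proof.
move=> S1; have S2 : (S.+1 <= 2 ^ S)%N by exact: ltn_expl.
have n2 : (n.+2 <= 2 ^ n.+1)%N by exact: ltn_expl.
have N2 : (4 * S.+1 <= 2 ^ S.+2)%N by rewrite (expnD 2 2 S) leq_mul.
have P2 : (((4 * S.+1) ^ n.+1) ^ 2 <= 2 ^ (S.+2 * n.+1 * 2))%N.
  by rewrite !expnM !leq_exp2r.
apply: (@leq_trans (2 ^ 18 * 2 ^ n.+1 * 2 ^ (S.+2 * n.+1 * 2) * 2 ^ S)%N).
  apply: leq_mul S2; apply: leq_mul P2; exact: (leq_mul (leqnn _) n2).
rewrite -!expnD leq_exp2l //; nia.
Qed.

(** A single layer at height 1 suffices: block permutations move points by less than S, so M = S and
    N = 4(S + 1). Conjugation by the unit vertical translation centres the slab at height 0. *)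
Lemma realize_permutation (R : realType) (n S : nat)
    (sigma : 'rV[int]_n.+1 -> 'rV[int]_n.+1) : (0 < S)%N ->
  block_perm R n.+1 S sigma ->
  exists Ups : 'rV[R]_n.+2 -> 'rV[R]_n.+2,
    bilip_on (2 ^+ (8 * n.+2 * S)) setT Ups /\
    (forall x, `|vcoord x| >= 2^-1 -> Ups x = x) /\
    (forall z, Ups (pt (zr z) 0) = pt (zr (sigma z)) 0).
Proof.
(* For S = 1 the constant of layers_to_points would exceed 2 ^ (8 d). *)
move=> S0 hs; have [S1|S1] := leqP S 1.
  have SE : S = 1%N by lia.
  exists id; split; last split=> // z.
    by move=> x y _ _; rewrite ler_peMl ?enorm_ge0 // exprn_ege1 //; lra.
  by rewrite (block1_perm R _ sigma) // -SE.
pose N := (4 * S.+1)%N; pose q z (k : nat) : 'rV[R]_n.+2 := pt (zr (sigma z)) 1.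
have [||||||||z k _|z k _|z k z' k' k1 k1' zk|F [hF [Fout FE]]] :=
  layers_to_points R n 1 N S%:R 1 4^-1 q; try by [].
- by rewrite /N natrM -[S.+1%:R]natr1 lexx.
- lra.
- rewrite /q hpartK; apply: mxnorm_le => // j; rewrite !mxE -intrB -intr_norm.
  by rewrite pmulrn ler_int ltW // (block_perm_displacement R).
- by rewrite /q vcoordK; apply/andP; split; lra.
- left; rewrite /q !hpartK; apply: zr_sep => e; apply: zk.
  have [/bij_inj inj _] := hs; rewrite (inj _ _ e); congr pair; lia.
exists (fun y => F (y + pt 0 1) - pt 0 1); split; last split.
- move=> x y _ _; move: hF; set C := (X in hvbilip X F) => hF.
  have C0 : 0 <= C by rewrite /C ?mulr_ge0 // ?addr_ge0 // ?divr_ge0 ?mulr_ge0.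
  have hCN : 2 * n.+2%:R * C <= 2 ^+ (8 * n.+2 * S).
    apply: (@le_trans _ _ (2 ^ 18 * n.+2 * (N ^ n.+1) ^ 2 * S.+1)%N%:R).
      rewrite !natrM !natrX -[S.+1%:R]natr1 /C.
      have P1 : 1 <= N%:R ^+ n.+1 :> R by rewrite exprn_ege1 // ler1n.
      have s0 : 0 <= S%:R :> R by [].
      move: (N%:R ^+ n.+1) (S%:R) P1 s0 => P s P1 s0.
      have -> : 2 * n.+2%:R * (4 * ((1 + 16 * P * 1 ^+ 2 / 1 + 1 / 4^-1) * (1 / 4^-1)) *
        (2 + 16 * P * (s + 1)) * 8) =
          n.+2%:R * (2 ^+ 8 * ((5 + 16 * P) * (2 + 16 * P * (s + 1)))) by field.
      have -> : 2 ^+ 18 * n.+2%:R * P ^+ 2 * (s + 1) =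
          n.+2%:R * (2 ^+ 8 * ((32 * P) * (32 * P * (s + 1)))) by ring.
      have Ps : 1 <= P * (s + 1) by nra.
      apply: ler_wpM2l => //; apply: ler_wpM2l; first by rewrite exprn_ge0.
      by apply: ler_pM; lra.
    rewrite -natrX ler_nat; exact: permutation_cost.
  have := bilip_le _ _ _ _ _ _ hCN (bilip_hvbilip _ _ _ _ C0 hF).
  move=> /(_ (x + pt 0 1) (y + pt 0 1) I I).
  by rewrite opprB addrA subrK opprD (addrACA x) subrr addr0.
- move=> x hx; rewrite Fout ?addrK // vcoordD vcoordK.
  move: hx; rewrite ler_normr => /orP[]; [right|left]; lra.
- move=> z; have ptD (u : 'rV[R]_n.+1) : pt u 0 + pt 0 1 = pt u 1.
    rewrite -[LHS]ptK; rewrite hpartD vcoordD !hpartK !vcoordK.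
    by rewrite addr0 add0r.
  by rewrite ptD (FE z 1%N isT : F (pt (zr z) 1) = _) /q -ptD addrK.
Qed.

Lemma F_class_exp (R : realType) (n : nat) :
  F_class R n.+1 (fun t => powR 2 (8 * n.+2%:R * t)).
Proof.
have k0 : 0 <= 8 * n.+2%:R :> R by [].
split; last split.
- move=> t t1 /=; have /= := @ler_powR R 2 _ 0 (8 * n.+2%:R * t).
  by rewrite powRr0; apply; [lra|rewrite mulr_ge0 //; lra].
- move=> s t s1 st /=; apply: ler_powR; first lra.
  by rewrite ler_wpM2l.
- move=> S sigma S0 hs; have := realize_permutation R n S sigma S0 hs.
  by rewrite -!natrM powR_mulrn.
Qed.

(** * Block reflections and the lower bound *)

(** On the block with coordinates from Sa to Sa + S - 1 this is the point reflection in the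
    centre. *)
Definition block_reflection {n : nat} (S : nat) (w : 'rV[int]_n) : 'rV[int]_n :=
  \row_j (S%:Z * divz (w 0 j) S%:Z *+ 2 + S%:Z - 1 - w 0 j).

Lemma divz_block (S : nat) (a w : int) :
  S%:Z * a <= w < S%:Z * a + S%:Z -> divz w S%:Z = a.
Proof.
move=> /andP[h1 h2]; have S0 : S%:Z != 0 by lia.
have -> : w = a * S%:Z + (w - a * S%:Z) by ring.
rewrite divzMDl // divz_small ?addr0 //; lia.
Qed.

Lemma block_reflection_perm (R : realType) (n S : nat) : (0 < S)%N ->
  block_perm R n S (block_reflection S).
Proof.
move=> S0.
have hb (z w : 'rV[int]_n) : block R n S z w -> block R n S z (block_reflection S w).
  move=> /blockP h; apply/blockP => j; have := h j.
  rewrite mxE => hj; rewrite (divz_block _ _ _ hj); lia.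
have invol (w : 'rV[int]_n) : block_reflection S (block_reflection S w) = w.
  have [z hz] : exists z, block R n S z w by eexists; exact: block_cover.
  have /blockP h := hz; have /blockP h' := hb _ _ hz.
  apply/rowP => j; rewrite mxE (divz_block _ _ _ (h' j)).
  rewrite mxE (divz_block _ _ _ (h j)); ring.
split; first by exists (block_reflection S).
move=> z; split=> [|w' hw']; first exact: hb.
by exists (block_reflection S w'); [exact: hb|exact: invol].
Qed.

(* The adjacent lattice points S - 1 and S lie in different blocks, and
   reflecting both blocks sends them to 0 and 2 S - 1. *)
Lemma F_class_ge (R : realType) (n S : nat) (psi : R -> R) : (0 < S)%N ->
  F_class R n.+1 psi -> 2 * S%:R - 1 <= psi S%:R.
Proof.
move=> S0 [psi1 [_ hpsi]].
have [Ups [hU [_ UE]]] := hpsi S _ S0 (block_reflection_perm R n.+1 S S0).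
pose w (a : int) : 'rV[int]_n.+1 := \row_j if j == 0 then a else 0.
have [h _] := hU (pt (zr (w S%:Z)) 0) (pt (zr (w (S%:Z - 1))) 0) I I.
rewrite !UE in h.
have e1 : enorm (pt (zr (w S%:Z)) 0 - pt (zr (w (S%:Z - 1))) 0) <= 1 :> R.
  apply: (le_trans (enorm_le_sum _ _ _)).
  rewrite (bigD1 (lift ord_max (0 : 'I_n.+1))) //= big1 => [|i i0].
    by rewrite !mxE liftK !mxE /= addr0 intrB opprB addrC subrK normr1.
  rewrite !mxE; case: unliftP i0 => [j ->|->]; last by rewrite subrr normr0.
  rewrite (inj_eq lift_inj) => j0; rewrite !mxE (negPf j0).
  by rewrite subrr normr0.
have := enorm_ge_coord _ _ (pt (zr (block_reflection S (w S%:Z))) 0 -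
   pt (zr (block_reflection S (w (S%:Z - 1)))) 0 : 'rV[R]_n.+2)
  (lift ord_max (0 : 'I_n.+1)).
rewrite !mxE !liftK !mxE /= (@divz_block S 1) ?(@divz_block S 0); [|lia|lia].
have e2 : 2 * S%:R - 1 <= `|2 * S%:R - 1| :> R := ler_norm _.
have -> : (S%:Z * 1 *+ 2 + S%:Z - 1 - S%:Z)%:~R -
   (S%:Z * 0 *+ 2 + S%:Z - 1 - (S%:Z - 1))%:~R = 2 * S%:R - 1 :> R.
  rewrite -intrB (_ : _ - _ = 2 * S%:Z - 1); last by ring.
  by rewrite intrB intrM.
move=> h1; have psiS : 1 <= psi S%:R by apply: psi1; rewrite ler1n.
apply: (le_trans e2); apply: (le_trans h1); apply: (le_trans h).
by rewrite ler_piMr //; lra.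
Qed.

(** * Comparison of the constants *)

Lemma powR_ge_exp (R : realType) (a x : R) (k : nat) :
  1 <= a -> k%:R <= x -> a ^+ k <= powR a x.
Proof.
by move=> a1 kx; rewrite -powR_mulrn ?ler_powR //; lra.
Qed.

(** [D], [HA], [HB] stand for the real powers of the dimension and of [H], [B] for the value of
    beta. Since [B] dominates its argument, it exceeds H^3 and (9LH)^2 >= N^2, so B^(n+2) absorbs
    H^3 and the square of P = N^(n+1). *)
Lemma extension_cost (R : realType) (n : nat) (d L H N D HA HB B : R) :
  1 <= d -> 1 <= L -> 1 <= H -> 0 <= N -> N <= 9 * L * H -> 1 <= N ->
  d ^+ 2 <= D -> H ^+ 2 <= HA -> H ^+ 3 <= HB ->
  2 ^+ 42 * D * L ^+ 10 * HB <= B ->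
  2 * d * (4 * ((1 + 16 * N ^+ n.+1 * H ^+ 2 / (L * d)^-1 + H / (4 * L)^-1) *
      (H / (4 * L)^-1)) * (2 + 16 * N ^+ n.+1 * (L * H + 1)) * 8) <=
  2 ^+ 38 * D * L ^+ 9 * HA * B ^+ (3 ^ n.+1).
Proof.
move=> d1 L1 H1 N0 N9 N1 dD HHA HHB TB.
have [d0 L0 H0] : [/\ 0 <= d, 0 <= L & 0 <= H] by split; lra.
have d21 : 1 <= d ^+ 2 by rewrite exprn_ege1.
have H21 : 1 <= H ^+ 2 by rewrite exprn_ege1.
have H31 : 1 <= H ^+ 3 by rewrite exprn_ege1.
have L39 : L ^+ 3 <= L ^+ 9 by rewrite ler_weXn2l.
have L31 : 1 <= L ^+ 3 by rewrite exprn_ege1.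
have L210 : L ^+ 2 <= L ^+ 10 by rewrite ler_weXn2l.
have L101 : 1 <= L ^+ 10 by rewrite exprn_ege1.
have hB1 : H ^+ 3 <= B.
  have c42 : 1 <= 2 ^+ 42 :> R by rewrite -natrX ler1n.
  have D1 : 1 <= D by lra.
  apply: le_trans TB; apply: (le_trans HHB); apply: ler_peMl; first by lra.
  by apply: mulr_ege1 => //; apply: mulr_ege1.
have hB2 : (9 * L * H) ^+ 2 <= B.
  apply: le_trans TB; have -> : (9 * L * H) ^+ 2 = 81 * 1 * L ^+ 2 * H ^+ 2 by ring.
  have H23 : H ^+ 2 <= HB by apply: le_trans HHB; rewrite ler_weXn2l.
  have c42 : 81 <= 2 ^+ 42 :> R by rewrite -natrX ler_nat.
  have D1 : 1 <= D by lra.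
  by do !(apply: ler_pM => //; rewrite ?mulr_ge0 ?sqr_ge0 //).
have B1 : 1 <= B by lra.
set P := N ^+ n.+1; have P1 : 1 <= P by rewrite exprn_ege1.
have P0 : 0 <= P by lra.
have PB : P ^+ 2 <= B ^+ n.+1.
  rewrite /P exprAC; apply: lerXn2r; rewrite ?nnegrE ?sqr_ge0 //; first lra.
  by apply: le_trans hB2; rewrite lerXn2r // nnegrE //; lra.
have BB : B * B ^+ n.+1 <= B ^+ (3 ^ n.+1).
  by rewrite -exprS; apply: ler_weXn2l => //; exact: ltn_expl.
apply: (@le_trans _ _ (2 ^+ 38 * D * L ^+ 9 * HA * (B * B ^+ n.+1))); last first.
  apply: ler_wpM2l => //; rewrite !mulr_ge0 ?exprn_ge0 //; lra.
apply: (@le_trans _ _ (2 ^+ 19 * d ^+ 2 * L ^+ 3 * H ^+ 2 * (H ^+ 3 * P ^+ 2))).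
  rewrite !invrK.
  have -> : 2 * d * (4 * ((1 + 16 * P * H ^+ 2 * (L * d) + H * (4 * L)) *
      (H * (4 * L))) * (2 + 16 * P * (L * H + 1)) * 8) =
     (256 * d * H * L) * ((1 + 16 * P * H ^+ 2 * (L * d) + H * (4 * L)) *
        (2 + 16 * P * (L * H + 1))) by ring.
  (* Every variable is at least 1, so each sum is at most a multiple of its leading monomial: 32 and
     64 round up 21 and 34. *)
  apply: (@le_trans _ _ ((256 * d * H * L) * ((32 * (P * H ^+ 2 * (L * d))) *
        (64 * (P * (L * H)))))).
    have LH1 : 1 <= L * H by apply: mulr_ege1.
    have PLH : P <= P * (L * H) by rewrite ler_peMr //; lra.
    have big : L * H <= P * H ^+ 2 * (L * d).
      have -> : P * H ^+ 2 * (L * d) = (L * H) * (P * H * d) by ring.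
      rewrite ler_peMr //; first lra.
      by apply: mulr_ege1 => //; apply: mulr_ege1.
    apply: ler_wpM2l; first by rewrite !mulr_ge0 //; lra.
    apply: ler_pM; [lra|lra|lra|lra].
  have -> : (256 * d * H * L) * ((32 * (P * H ^+ 2 * (L * d))) *
      (64 * (P * (L * H)))) =
      2 ^+ 19 * (d ^+ 2 * L ^+ 3 * H ^+ 2 * (H ^+ 2 * P ^+ 2)) by ring.
  have -> : 2 ^+ 19 * d ^+ 2 * L ^+ 3 * H ^+ 2 * (H ^+ 3 * P ^+ 2) =
      2 ^+ 19 * (d ^+ 2 * L ^+ 3 * H ^+ 2 * (H ^+ 3 * P ^+ 2)) by ring.
  apply: ler_wpM2l; first by rewrite exprn_ge0.
  apply: ler_wpM2l; first by rewrite !mulr_ge0 ?exprn_ge0.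
  by apply: ler_wpM2r; [exact: sqr_ge0|exact: ler_weXn2l].
have d20 : 0 <= d ^+ 2 by lra.
have c38 : 2 ^+ 19 <= 2 ^+ 38 :> R by rewrite ler_weXn2l //; lra.
have [L30 H20 H30 P20] : [/\ 0 <= L ^+ 3, 0 <= H ^+ 2, 0 <= H ^+ 3 & 0 <= P ^+ 2].
  by rewrite !exprn_ge0 //; lra.
by do !(apply: ler_pM => //; rewrite ?mulr_ge0 //).
Qed.

(** * Bounds for the infimum beta *)

(** [inf] is a true infimum only on a nonempty set bounded below; the exponential member and the
    bound 1 provide this. *)
Lemma beta_has_inf (R : realType) (n : nat) (t : R) : 1 <= t ->
  has_inf [set psi t | psi in F_class R n.+1].
Proof.
move=> t1; split; first by eexists; eexists; first exact: F_class_exp.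
by exists 1 => _ [psi [h _] <-]; exact: h.
Qed.

Lemma beta_glb (R : realType) (n : nat) (t c : R) : 1 <= t ->
  (forall psi, F_class R n.+1 psi -> c <= psi t) -> c <= beta R n.+1 t.
Proof.
move=> t1 h; apply: lb_le_inf; first by case: (beta_has_inf R n t t1).
by move=> _ [psi hpsi <-]; exact: h.
Qed.

Lemma beta_le (R : realType) (n : nat) (t : R) psi : 1 <= t ->
  F_class R n.+1 psi -> beta R n.+1 t <= psi t.
Proof.
move=> t1 h; apply: ge_inf; first by case: (beta_has_inf R n t t1).
by exists psi.
Qed.

Lemma beta_ge_floor (R : realType) (n : nat) (t : R) : 1 <= t ->
  (2 * Num.floor t - 1)%:~R <= beta R n.+1 t.
Proof.
move=> t1; apply: beta_glb => // psi hpsi.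
have f1 : 1 <= Num.floor t by rewrite floor_ge_int.
case e : (Num.floor t) f1 => [S|//] S1.
have S0 : (0 < S)%N by [].
have St : S%:R <= t by rewrite pmulrn -[Posz S]/(S%:Z) -e floor_le_tmp.
have := F_class_ge R n S psi S0 hpsi; have [_ [mono _]] := hpsi.
have : psi S%:R <= psi t by apply: mono => //; rewrite ler1n.
rewrite intrB intrM -[(Posz S)%:~R]/(S%:R); lra.
Qed.

(** 2 floor(t) - 1 > 2t - 3 >= t. *)
Lemma beta_ge_id (R : realType) (n : nat) (t : R) : 3 <= t -> t <= beta R n.+1 t.
Proof.
move=> t3; have t1 : 1 <= t by lra.
apply: le_trans _ (beta_ge_floor R n t t1).
have /andP[_] := floor_itv t; rewrite intrD intrB intrM; lra.
Qed.

(** * Extension of bilipschitz maps from planes and lattice layers *)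

Lemma lattice_layers_pt (R : realType) (n H : nat) (z : 'rV[int]_n) (k : nat) :
  (1 <= k <= H)%N -> lattice_layers R n H (pt (zr z) k%:R).
Proof.
move=> kH; split; last by exists k; rewrite vcoordK.
by move=> j; rewrite hpartK mxE; exists (z 0 j).
Qed.

Lemma lattice_layersP (R : realType) (n H : nat) (x : 'rV[R]_n.+1) :
  lattice_layers R n H x ->
  exists z k, (1 <= k <= H)%N /\ x = pt (zr z) k%:R.
Proof.
move=> [/choice[z hz] [k [kH xk]]]; exists (\row_j z j), k; split=> //.
by rewrite -[LHS]ptK xk; congr pt; apply/rowP => j; rewrite !mxE -hz mxE.
Qed.

(** [B] stands for the value of beta, bounded below by its argument. The bilipschitz condition
    supplies the parameters of [layers_to_points], with M = LH. *)
Lemma bilip_extension (R : realType) (n H : nat) (L B : R)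
    (f : 'rV[R]_n.+2 -> 'rV[R]_n.+2) :
  (1 <= H)%N -> 1 <= L ->
  bilip_on L (ext_domain R n.+1 H) f ->
  (forall x, boundary_planes R n.+1 H x -> f x = x) ->
  (forall x, lattice_layers R n.+1 H x -> slab R n.+1 H (f x)) ->
  2 ^+ 42 * powR n.+2%:R (9 / 2) * L ^+ 10 * powR H%:R (3 + 3 / n.+1%:R) <= B ->
  exists F : 'rV[R]_n.+2 -> 'rV[R]_n.+2,
    (forall x, ext_domain R n.+1 H x -> F x = f x) /\
    bilip_on (2 ^+ 38 * powR n.+2%:R (9 / 2) * L ^+ 9
      * powR H%:R (2 + 3 / n.+1%:R) * B ^+ (3 ^ n.+1)) setT F.
Proof.
move=> H1 L1 fL fid fslab TB.
have L0 : 0 < L by lra.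
have H1R : 1 <= H%:R :> R by rewrite ler1n.
have d1 : 1 <= n.+2%:R :> R by rewrite ler1n.
have LH : 1 <= L * H%:R by apply: mulr_ege1.
(* Images of lattice points are 1/L apart, hence 1/(Ld) apart horizontally or vertically. They keep
   distance 1/(2L) from the planes; half of this is taken so that eta <= 1/4. *)
pose d : R := n.+2%:R; pose s := (L * d)^-1; pose eta := (4 * L)^-1.
(* The successor makes N exceed 4(LH + 1); N <= 4LH + 5 <= 9LH because LH >= 1. *)
pose N := (Num.truncn (4 * (L * H%:R + 1))).+1.
have /andP[N9 NM] : N.-1%:R <= 4 * (L * H%:R + 1) < N%:R by apply: truncn_itv; lra.
have N9' : N%:R <= 9 * L * H%:R by rewrite /N -natr1 -[Num.truncn _]/N.-1; lra.
pose q (z : 'rV[int]_n.+1) (k : nat) := f (pt (zr z) k%:R).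
have lay z k : (1 <= k <= H)%N -> ext_domain R n.+1 H (pt (zr z) k%:R).
  by move=> kH; right; exact: lattice_layers_pt.
have bot x : boundary_planes R n.+1 H (pt x 2^-1) by left; rewrite vcoordK.
have top x : boundary_planes R n.+1 H (pt x (H%:R + 2^-1)) by right; rewrite vcoordK.
have kR (k : nat) : (1 <= k <= H)%N -> 1 <= (k%:R : R) <= H%:R.
  by move=> /andP[k1 kH]; rewrite ler1n k1 ler_nat.
(* The image is compared with its vertical projection to a plane, a point fixed by f. *)
have near z k b : (1 <= k <= H)%N -> boundary_planes R n.+1 H b ->
    hpart b = hpart (q z k) -> 2^-1 <= `|k%:R - vcoord b| ->
    2 * eta <= `|vcoord (q z k) - vcoord b|.
  move=> kH hb hbq kb; have [_] := fL _ b (lay z k kH) (or_introl hb).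
  rewrite (fid b hb) -/(q z k) (@enorm_vertical _ _ (q z k - b)); last first.
    by rewrite hpartB hbq subrr.
  rewrite vcoordB => h.
  have : 2^-1 <= L * `|vcoord (q z k) - vcoord b|.
    apply: le_trans h; apply: (le_trans kb).
    have := enorm_ge_coord R n.+2 (pt (zr z) k%:R - b) ord_max.
    by rewrite -/(vcoord _) vcoordB vcoordK.
  have -> : 2 * eta = 2^-1 / L by rewrite /eta; field; rewrite gt_eqF.
  by rewrite ler_pdivrMr // mulrC.
have eta0 : 0 < eta by rewrite invr_gt0; lra.
have [||||||||z k kH|z k kH|z k z' k' kH kH' zk|F [hF [Fout FE]]] :=
  layers_to_points R n H N (L * H%:R) s eta q; try by [].
- lra.
- exact: ltW.
- by rewrite invr_gt0 mulr_gt0 //; lra.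
- by rewrite /s invf_le1; [apply: mulr_ege1|apply: mulr_gt0 => //; rewrite /d; lra].
- by rewrite lef_pV2 ?posrE //; lra.
- have -> : 8 * eta = (2^-1 * L)^-1 by rewrite /eta; field; rewrite gt_eqF.
  rewrite lef_pV2 ?posrE ?mulr_gt0 //; try lra.
  by rewrite (mulrC 2^-1) ler_pM2l //; rewrite /d; lra.
(* Comparison with the fixed point below (z,k) on the lower plane bounds the displacement by L(k -
   1/2) <= LH. *)
- have [h _] := fL _ (pt (zr z) 2^-1) (lay z k kH) (or_introl (bot _)).
  move: h; rewrite (fid _ (bot _)) -/(q z k).
  rewrite (@enorm_vertical _ _ (pt _ _ - pt _ _)); last first.
    by rewrite hpartB !hpartK subrr.
  rewrite vcoordB !vcoordK => h.
  have : `|hpart (q z k) - zr z| <= enorm (q z k - pt (zr z) 2^-1).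
    apply: mxnorm_le => [|j]; first exact: enorm_ge0.
    apply: le_trans _ (enorm_ge_coord _ _ _ (lift ord_max j)).
    by rewrite !mxE liftK mxE.
  have /andP[k1 k2] := kR k kH.
  rewrite ger0_norm in h; last by lra.
  have : L * (k%:R - 2^-1) <= L * H%:R by apply: ler_wpM2l; lra.
  lra.
- have /andP[k1 k2] := kR k kH.
  have /andP[v1 v2] : slab R n.+1 H (q z k).
    by apply: fslab; exact: lattice_layers_pt.
  have := near z k _ kH (bot (hpart (q z k))).
  have := near z k _ kH (top (hpart (q z k))).
  rewrite !hpartK !vcoordK => /(_ erefl) h2 /(_ erefl) h1.
  have : 2 * eta <= `|vcoord (q z k) - 2^-1|.
    by apply: h1; rewrite ger0_norm; lra.
  have : 2 * eta <= `|vcoord (q z k) - (H%:R + 2^-1)|.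
    by apply: h2; rewrite distrC ger0_norm; lra.
  rewrite distrC !ger0_norm; [|lra|lra].
  by move=> *; apply/andP; split; lra.
- apply/orP; rewrite -[_ || _]negbK negb_or -!ltNge; apply/negP => /andP[h v].
  have [_ hL] := fL _ _ (lay z k kH) (lay z' k' kH').
  have p1 : 1 <= enorm (pt (zr z) k%:R - pt (zr z') k'%:R) :> R.
    have [e|ne] := pselect (z = z'); last first.
      apply: (le_trans (zr_sep R _ _ _ ne)).
      apply: mxnorm_le => [|j]; first exact: enorm_ge0.
      apply: le_trans _ (enorm_ge_coord _ _ _ (lift ord_max j)).
      by rewrite !mxE liftK !mxE.
    have kk' : k%:Z <> k'%:Z by move=> [kk']; apply: zk; rewrite e kk'.
    apply: (le_trans (int_sep R _ _ kk')).
    have := enorm_ge_coord R n.+2 (pt (zr z) k%:R - pt (zr z') k'%:R) ord_max.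
    by rewrite -/(vcoord _) vcoordB !vcoordK.
  have := enorm_le_hpart_vcoord _ _ (q z k - q z' k').
  rewrite hpartB vcoordB => hq.
  have : enorm (q z k - q z' k') < d * s.
    apply: (le_lt_trans hq); rewrite /d -[n.+2%:R]natr1 mulrDl mul1r.
    by apply: ler_ltD => //; apply: ler_wpM2l => //; exact: ltW.
  rewrite -(ltr_pM2l L0) mulrA divff ?gt_eqF ?mulr_gt0 //; lra.
exists F; split.
  move=> x [hx|hx].
    by rewrite (fid x hx) Fout //; case: hx => ->; [left|right].
  by have [z [k [kH ->]]] := lattice_layersP _ _ _ _ hx; exact: FE.
move: hF; set C := (X in hvbilip X F) => hF.
have C0 : 0 <= C.
  have := hF 0 (pt 0 1) => -[h _].
  have e : hvnorm (0 - pt 0 1 : 'rV[R]_n.+2) = 1.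
    by rewrite /hvnorm hpartB vcoordB hpartK vcoordK hpart0 vcoord0 !sub0r !normrN normr0 normr1 add0r.
  by move: h; rewrite e mulr1; apply: le_trans; exact: hvnorm_ge0.
apply: bilip_le (bilip_hvbilip _ _ _ _ C0 hF).
apply: (extension_cost _ _ _ _ _ _ _ _ (powR H%:R (3 + 3 / n.+1%:R))) => //.
- by rewrite ler1n.
- by apply: powR_ge_exp; [|lra].
- by apply: powR_ge_exp; [|rewrite lerDl divr_ge0].
- by apply: powR_ge_exp; [|rewrite lerDl divr_ge0].
Qed.

(* d is the ambient dimension; points of R^d are 'rV[R]_(d.-1.+1) (= 'rV_d as d >= 2),
   with the last coordinate the vertical one. *)
Theorem theorem6p1 (R : realType) (d : nat) (hd : (2 <= d)%N) :
  (forall t : R, 1 <= t -> 1 <= beta R d.-1 t) /\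
  (forall s t : R, 1 <= s -> s <= t -> beta R d.-1 s <= beta R d.-1 t) /\
  (forall t : R, 1 <= t ->
     (2 * Num.floor t - 1)%:~R <= beta R d.-1 t /\
     beta R d.-1 t <= powR 2 (8 * d%:R * t)) /\
  (forall (H : nat) (L : R) (f : 'rV[R]_(d.-1.+1) -> 'rV[R]_(d.-1.+1)),
     (1 <= H)%N -> 1 <= L ->
     bilip_on L (ext_domain R d.-1 H) f ->
     (forall x, boundary_planes R d.-1 H x -> f x = x) ->
     (forall x, lattice_layers R d.-1 H x -> slab R d.-1 H (f x)) ->
     exists F : 'rV[R]_(d.-1.+1) -> 'rV[R]_(d.-1.+1),
       (forall x, ext_domain R d.-1 H x -> F x = f x) /\
       bilip_on
         (2 ^+ 38 * powR d%:R (9 / 2) * L ^+ 9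
            * powR H%:R (2 + 3 / (d.-1)%:R)
            * beta R d.-1 (2 ^+ 42 * powR d%:R (9 / 2) * L ^+ 10
                             * powR H%:R (3 + 3 / (d.-1)%:R)) ^+ (3 ^ d.-1))
         setT F).
Proof.
case: d hd => [|[|n]] // _; rewrite [n.+2.-1]/=; split; last split; last split.
- by move=> t t1; apply: beta_glb => // psi [h _]; exact: h.
- move=> s t s1 st; have t1 : 1 <= t by lra.
  apply: beta_glb => // psi hpsi; have [_ [mono _]] := hpsi.
  exact: le_trans (beta_le _ _ _ _ s1 hpsi) (mono _ _ s1 st).
- by move=> t t1; split; [exact: beta_ge_floor|exact: beta_le (F_class_exp R n)].
- move=> H L f H1 L1 fL fid fslab; apply: bilip_extension => //.
  apply: beta_ge_id.
  have D1 : 1 <= powR n.+2%:R (9 / 2) :> R.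
    by have := powR_ge_exp R n.+2%:R (9 / 2) 0; rewrite expr0; apply; [rewrite ler1n|lra].
  have H3 : 1 <= powR H%:R (3 + 3 / n.+1%:R) :> R.
    have := powR_ge_exp R H%:R (3 + 3 / n.+1%:R) 0; rewrite expr0; apply.
      by rewrite ler1n.
    by rewrite addr_ge0 // divr_ge0.
  have c42 : 3 <= 2 ^+ 42 :> R by rewrite -natrX ler_nat.
  have L10 : 1 <= L ^+ 10 by rewrite exprn_ege1.
  move: (2 ^+ 42) (L ^+ 10) c42 L10 => c l c42 l1; apply: (le_trans c42).
  rewrite -!mulrA; apply: ler_peMr; first by lra.
  by apply: mulr_ege1 => //; apply: mulr_ege1.
Qed.
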